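(* Let $\mathbb K$ be a field, let $G=([n],E(G))$ be a simple graph, let $\mathcal S=(S_{ij})$ be a family of gain sets on $G$ with values in $\mathbb K$, and let $\mathcal A(G_{\mathcal S})$ be the associated affine arrangement in $\mathbb K^n$. If the cone $c\mathcal A(G_{\mathcal S})$ is free, then $G$ is chordal.
   Context: Gain sets: $\mathcal S=(S_{ij})$ is a family of finite subsets of $\mathbb K$ indexed by ordered pairs of distinct vertices of $G$, with $S_{ji}=-S_{ij}=\{-a\mid a\in S_{ij}\}$ and $S_{ij}\neq\emptyset$ if and only if $ij\in E(G)$. Put $H_{ij}^a=\{x\in\mathbb K^n\mid x_i-x_j=a\}$ and $\mathcal A(G_{\mathcal S})=\{H_{ij}^a\mid a\in S_{ij},\ i<j\}$. Cone: with an extra coordinate $y$, $c\mathcal A(G_{\mathcal S})=\{cH_{ij}^a\mid a\in S_{ij},\ i<j\}\cup\{H_\infty\}$ in $\mathbb K^{n+1}$, where $cH_{ij}^a=\{(x,y)\mid x_i-x_j=ay\}$ and $H_\infty=\{y=0\}$. Freeness: a central arrangement $\mathcal B$ of linear hyperplanes with defining polynomial $Q$ (the product of one linear form per hyperplane) in the polynomial coordinate ring $R$ over $\mathbb K$ is free if $D(\mathcal B)=\{\theta\in\operatorname{Der}_{\mathbb K}(R)\mid\theta(Q)\in QR\}$ is a free $R$-module, where $\operatorname{Der}_{\mathbb K}(R)$ is the $R$-module of $\mathbb K$-derivations of $R$. A graph is chordal if every cycle of length at least four has a chord. *)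

(* Defs.v *)
From HB Require Import structures.
From mathcomp Require Import all_boot all_order all_algebra.
From mathcomp Require Import finmap.
From mathcomp Require Import boolp classical_sets functions cardinality fsbigop.
From mathcomp Require Import mpoly.

Set Implicit Arguments.
Unset Strict Implicit.
Unset Printing Implicit Defensive.

Import GRing.Theory.

Local Open Scope classical_set_scope.
Local Open Scope ring_scope.

Definition simple_graph (T : eqType) (e : rel T) : Prop :=
  ssrbool.symmetric e /\ irreflexive e.

(* [ucycle e c] lists each vertex of the cycle [c] once, without repeating the
   first one at the end; two vertices of [c] are adjacent along the cycle when
   one of them is the [next] of the other. *)
Definition has_chord (T : eqType) (e : rel T) (c : seq T) : Prop :=
  exists x y, [/\ x \in c, y \in c, e x y, y != next c x & x != next c y].

Definition chordal (T : eqType) (e : rel T) : Prop :=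
  forall c : seq T, (4 <= size c)%N -> ucycle e c -> has_chord e c.

Definition gain_family (K : fieldType) (n : nat) (E : rel 'I_n)
    (S : 'I_n -> 'I_n -> {fset K}) : Prop :=
  forall i j, i != j ->
    S j i = [fset - a | a in S i j]%fset /\ (S i j != fset0 <-> E i j).

Section GainArrangement.

Variables (K : fieldType) (n : nat) (S : 'I_n -> 'I_n -> {fset K}).

Definition gain_hyperplane (i j : 'I_n) (a : K) : set 'rV[K]_n :=
  [set x : 'rV[K]_n | x ord0 i - x ord0 j = a].

Definition gain_arrangement : set (set 'rV[K]_n) :=
  [set H | exists (i j : 'I_n) (a : K),
     [/\ (i < j)%N, a \in S i j & H = gain_hyperplane i j a]].

(* Points of K^(n+1) are pairs (x, y): the coordinates of x are indexed by
   [lift ord_max i] for [i : 'I_n], and y is the coordinate [ord_max]. *)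
Definition cone_hyperplane (i j : 'I_n) (a : K) : set 'rV[K]_n.+1 :=
  [set v : 'rV[K]_n.+1 | v ord0 (lift ord_max i) - v ord0 (lift ord_max j)
           = a * v ord0 ord_max].

Definition hyperplane_at_infinity : set 'rV[K]_n.+1 :=
  [set v : 'rV[K]_n.+1 | v ord0 ord_max = 0].

Definition gain_cone : set (set 'rV[K]_n.+1) :=
  [set H | exists (i j : 'I_n) (a : K),
     [/\ (i < j)%N, a \in S i j & H = cone_hyperplane i j a]]
  `|` [set hyperplane_at_infinity].

Lemma cone_hyperplane_section (i j : 'I_n) (a : K) (x : 'rV[K]_n) :
  cone_hyperplane i j a
    (\row_k (if unlift ord_max k is Some l then x ord0 l else 1))
  <-> gain_hyperplane i j a x.
Proof.
by rewrite /cone_hyperplane /gain_hyperplane /= !mxE !liftK unlift_none mulr1.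
Qed.

End GainArrangement.

Definition free_submodule (R : nzRingType) (V : lmodType R) (N : set V) : Prop :=
  exists B : set V,
    [/\ B `<=` N,
        forall v, N v -> exists (s : seq V) (c : V -> R),
          (forall b, b \in s -> B b) /\ v = \sum_(b <- s) c b *: b &
        forall (s : seq V) (c : V -> R), uniq s -> (forall b, b \in s -> B b) ->
          \sum_(b <- s) c b *: b = 0 -> forall b, b \in s -> c b = 0].

Section Freeness.

Variables (K : fieldType) (m : nat).

Definition linear_form_of (H : set 'rV[K]_m) (p : {mpoly K[m]}) : Prop :=
  [/\ p \is 1.-homog, p != 0 & H = [set v : 'rV[K]_m | p.@[v ord0] = 0]].

Definition defining_polynomial (B : set (set 'rV[K]_m)) (Q : {mpoly K[m]}) :
    Prop :=
  finite_set B /\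
  exists alpha : set 'rV[K]_m -> {mpoly K[m]},
    (forall H, B H -> linear_form_of H (alpha H)) /\
    Q = \big[*%R/1]_(H \in B) alpha H.

Definition derivation (theta : {mpoly K[m]} -> {mpoly K[m]}) : Prop :=
  linear theta /\ forall p q, theta (p * q) = theta p * q + p * theta q.

(* The codomain [{mpoly K[m]}^o] makes the type of functions a module over the
   polynomial ring, with pointwise operations. *)
Definition log_derivations (Q : {mpoly K[m]}) :
    set ({mpoly K[m]} -> {mpoly K[m]}^o) :=
  [set theta | derivation theta /\ exists g, theta Q = Q * g].

(* Two defining polynomials of [B] differ by a nonzero scalar, so the module of
   logarithmic derivations does not depend on the choice of [Q]. *)
Definition free_arrangement (B : set (set 'rV[K]_m)) : Prop :=
  exists Q, defining_polynomial B Q /\ free_submodule (log_derivations Q).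

End Freeness.

(* Main.v *)
Require Import Defs.
From mathcomp Require Import all_boot all_order all_algebra finmap.
From mathcomp Require Import boolp classical_sets functions cardinality fsbigop.
From mathcomp Require Import mpoly ring.

(** Let c be a chordless cycle of length at least four.  Put
    [b_i = x_i - x_(next i)] for i on c, let P_i be the product of the forms
    [b_i - a y] over the gains a of the edge [i, next i], and let L be the
    product of the forms of those hyperplanes that do not contain the flat
    [X = {y = 0 and all x_i with i on c are equal}].  Because c is chordless, the
    hyperplanes through X are exactly the one at infinity and those whose form
    divides some P_i.

    Near X a logarithmic derivation kills y once a multiple of the Euler field is
    subtracted.  It then sends each b_i to some P_i h_i, and the b_i add up to 0,
    so it amounts to a syzygy of the family P.  The ideal I generated by the P_i is proper and contains
    a regular sequence of length three, so its syzygy module is not free.  The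
    proof makes this concrete, and multiplication by L replaces localization at
    X.

    Take consecutive vertices v1, v2, v3, v4 of c.  The derivations
    [u1 = L P2 P3 d/dx_v3], [u2 = - L P1 P3 (d/dx_v2 + d/dx_v3)] and
    [u3 = L P1 P2 d/dx_v2] are logarithmic, and P1 u1 + P2 u2 + P3 u3 = 0.  The
    sequence P1, P2, P3 is regular ([koszul_P123]), which uses that v1, v2, v3, v4
    are distinct, hence length at least four.  If the module were free, u1 would
    therefore be [P2 p + P3 q] with p and q logarithmic ([free_koszul]).  Reading
    this equality on each b_i and using that a logarithmic derivation acts on b_i,
    up to a multiple of the Euler field, through a multiple of P_i
    ([log_derivation_cycle]) gives L in I ([away_in_ideal]).  Restriction to X
    kills I but not L ([collapse_cycle_prod], [collapse_away]): a contradiction.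

    Divisibility by a linear form [X_k - r], with r free of X_k, is tested by
    substituting r for X_k.  This substitution is a ring morphism into a domain,
    which replaces any appeal to unique factorization. *)

Set Implicit Arguments.
Unset Strict Implicit.
Unset Printing Implicit Defensive.

Import GRing.Theory.

Local Open Scope ring_scope.

(** * Divisibility by linear forms *)

Definition divides (R : comNzRingType) (p f : R) : Prop := exists g, f = p * g.

Section Divides.
Variable R : comNzRingType.
Implicit Types p q f g : R.

Lemma divides_refl p : divides p p.
Proof. by exists 1; rewrite mulr1. Qed.

Lemma divides0 p : divides p 0.
Proof. by exists 0; rewrite mulr0. Qed.

Lemma dividesD p f g : divides p f -> divides p g -> divides p (f + g).
Proof. by move=> [u ->] [v ->]; exists (u + v); rewrite mulrDr. Qed.

Lemma dividesN p f : divides p f -> divides p (- f).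
Proof. by move=> [u ->]; exists (- u); rewrite mulrN. Qed.

Lemma divides_mull p f g : divides p f -> divides p (g * f).
Proof. by move=> [u ->]; exists (g * u); rewrite mulrCA. Qed.

Lemma divides_mulr p f g : divides p f -> divides p (f * g).
Proof. by rewrite mulrC; apply: divides_mull. Qed.

Lemma divides_trans p q f : divides p q -> divides q f -> divides p f.
Proof. by move=> pq [u ->]; apply: divides_mulr. Qed.

Lemma divides_prod (I : eqType) (s : seq I) (P : pred I) (F : I -> R) i :
  i \in s -> P i -> divides (F i) (\prod_(j <- s | P j) F j).
Proof.
by move=> si Pi; rewrite (big_rem i) //= Pi; apply/divides_mulr/divides_refl.
Qed.

End Divides.

Section Substitution.
Variables (K : fieldType) (m : nat).
Implicit Types (k : 'I_m) (f g r : {mpoly K[m]}).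

Definition subst k r : {rmorphism {mpoly K[m]} -> {mpoly K[m]}} :=
  comp_mpoly [tuple if i == k then r else 'X_i | i < m].

Lemma substX k r i : subst k r 'X_i = if i == k then r else 'X_i.
Proof. by rewrite [LHS]comp_mpolyXU -tnth_nth tnth_mktuple. Qed.

Lemma substZ k r a f : subst k r (a *: f) = a *: subst k r f.
Proof. exact: comp_mpolyZ. Qed.

(** [subst k r] is the identity modulo [X_k - r] on variables, hence everywhere. *)
Lemma subst_congr k r f : divides ('X_k - r) (f - subst k r f).
Proof.
elim/mpolyind: f => [|c u f _ _ IH].
  by rewrite rmorph0 subrr; apply: divides0.
rewrite rmorphD substZ opprD addrACA -scalerBr; apply: dividesD => //.
rewrite -mul_mpolyC; apply: divides_mull.
rewrite (mpolyXE_id _ u); elim/big_ind: _ => [|f1 f2 h1 h2|i _].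
- by rewrite rmorph1 subrr; apply: divides0.
- rewrite rmorphM.
  have -> : f1 * f2 - subst k r f1 * subst k r f2 =
    f2 * (f1 - subst k r f1) + subst k r f1 * (f2 - subst k r f2) by ring.
  by apply: dividesD; apply: divides_mull.
- rewrite rmorphXn subrXX; apply: divides_mulr.
  rewrite /= substX; case: eqP => [->|_]; first exact: divides_refl.
  by rewrite subrr; apply: divides0.
Qed.

Lemma divides_subst k r f : subst k r f = 0 -> divides ('X_k - r) f.
Proof. by move=> h; have := subst_congr k r f; rewrite h subr0. Qed.

(** Being fixed by every substitution for X_k says that X_k does not occur, in a
    form that passes through ring operations without looking at monomials. *)
Definition free_of k f := forall q, subst k q f = f.

Lemma free_of0 k : free_of k 0.
Proof. by move=> q; rewrite rmorph0. Qed.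

Lemma free_ofX k i : i != k -> free_of k 'X_i.
Proof. by move=> ik q; rewrite substX (negbTE ik). Qed.

Lemma free_ofD k f g : free_of k f -> free_of k g -> free_of k (f + g).
Proof. by move=> hf hg q; rewrite rmorphD hf hg. Qed.

Lemma free_ofZ k a f : free_of k f -> free_of k (a *: f).
Proof. by move=> hf q; rewrite substZ hf. Qed.

Lemma free_ofB k f g : free_of k f -> free_of k g -> free_of k (f - g).
Proof. by move=> hf hg q; rewrite rmorphB hf hg. Qed.

Lemma free_of_prod k (I : Type) (s : seq I) (F : I -> {mpoly K[m]}) :
  (forall i, free_of k (F i)) -> free_of k (\prod_(i <- s) F i).
Proof. by move=> hF q; rewrite rmorph_prod; apply: eq_bigr => i _; apply: hF. Qed.

Lemma subst_divides k r f :
  free_of k r -> divides ('X_k - r) f -> subst k r f = 0.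
Proof.
by move=> hr [g ->]; rewrite rmorphM rmorphB /= substX eqxx hr subrr mul0r.
Qed.

(** Substituting [r + 1] for X_k turns [X_k - r] into 1. *)
Lemma XB_neq0 k r : free_of k r -> 'X_k - r != 0.
Proof.
move=> hr; apply/eqP => /(congr1 (subst k (r + 1))).
rewrite rmorphB rmorph0 /= substX eqxx hr addrC addKr.
by apply/eqP/oner_neq0.
Qed.

Section Product.
Variables (T : eqType) (k : 'I_m) (r : T -> {mpoly K[m]}).
Hypothesis free_r : forall a, free_of k (r a).
Implicit Types s : seq T.

Lemma prod_XB_neq0 s : \prod_(a <- s) ('X_k - r a) != 0.
Proof. by rewrite prodf_seq_neq0; apply/allP => a _; apply: XB_neq0. Qed.

(** A product of forms [X_k - r a] is regular modulo a nonzero f free of X_k: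
    in [(X_k - r a) u = f v] the substitution kills the left side and fixes f, so
    it kills v, and [X_k - r a] can be cancelled. *)
Lemma nonzerodiv_mod_free s f u : f != 0 -> free_of k f ->
  divides f (\prod_(a <- s) ('X_k - r a) * u) -> divides f u.
Proof.
move=> f0 kf; elim: s => [|a s IH]; first by rewrite big_nil mul1r.
rewrite big_cons -mulrA => -[v e]; apply: IH.
have /divides_subst [w wE] : subst k (r a) v = 0.
  have := congr1 (subst k (r a)) e.
  rewrite !rmorphM rmorphB /= substX eqxx free_r subrr mul0r kf.
  by move/esym/eqP; rewrite mulf_eq0 (negbTE f0) => /eqP.
exists w; apply: (mulfI (XB_neq0 (free_r a))).
by rewrite e wE mulrCA.
Qed.

(** The same modulo the ideal (f, g).  Substituting in
    [(X_k - r a) c = f u + g v] makes [(phi u, phi v)] a syzygy of (f, g), which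
    is a multiple of [(g, - f)] by coprimality and so contributes nothing to
    [f u + g v]; the remainders [u - phi u] and [v - phi v] are divisible by
    [X_k - r a]. *)
Lemma nonzerodiv_mod_pair s f g u v c : free_of k f -> free_of k g ->
  g != 0 -> (forall w, divides g (f * w) -> divides g w) ->
  \prod_(a <- s) ('X_k - r a) * c = f * u + g * v ->
  exists u' v', c = f * u' + g * v'.
Proof.
move=> kf kg g0 copr; elim: s c u v => [|a s IH] c u v.
  by rewrite big_nil mul1r => ->; exists u, v.
rewrite big_cons -mulrA => e.
set phi := subst k (r a).
have [u1 u1E] := subst_congr k (r a) u.
have [v1 v1E] := subst_congr k (r a) v.
have e0 : f * phi u + g * phi v = 0.
  have := congr1 phi e.
  by rewrite !(rmorphM, rmorphB, rmorphD) /= substX eqxx free_r subrr mul0r kf kg.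
have [w wE] : divides g (phi u).
  by apply: copr; exists (- phi v); rewrite mulrN; apply/eqP; rewrite -addr_eq0 e0.
have vE : phi v = - (f * w).
  apply: (mulfI g0); apply/eqP; rewrite mulrN -addr_eq0 addrC -e0 wE.
  by apply/eqP; ring.
apply: (IH _ u1 v1); apply: (mulfI (XB_neq0 (free_r a))).
rewrite e -[u in LHS](subrK (phi u)) -[v in LHS](subrK (phi v)) u1E v1E wE vE.
by ring.
Qed.

(** The forms are pairwise coprime, as [X_k - r b] becomes the nonzero
    [r a - r b] under the substitution of r a. *)
Lemma prod_divides s f : injective r -> uniq s ->
  (forall a, a \in s -> divides ('X_k - r a) f) ->
  divides (\prod_(a <- s) ('X_k - r a)) f.
Proof.
move=> inj_r; elim: s => [_ _|a s IH /= /andP[nas us] h].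
  by rewrite big_nil; exists f; rewrite mul1r.
have [|g gE] := IH us; first by move=> b sb; apply: h; rewrite inE sb orbT.
have /(subst_divides (free_r a)) := h a (mem_head _ _).
rewrite gE rmorphM /= => /eqP; rewrite mulf_eq0 => /orP[|/eqP/divides_subst].
  rewrite rmorph_prod prodf_seq_eq0 => /hasP[b sb] /=.
  rewrite rmorphB /= substX eqxx free_r subr_eq0 => /eqP /inj_r ab.
  by rewrite ab sb in nas.
by move=> [g1 ->]; exists g1; rewrite big_cons mulrCA mulrA.
Qed.

End Product.
End Substitution.

(** * Koszul relations in a free module *)

Section FreeSubmodule.
Variables (R : comNzRingType) (V : lmodType R) (N : set V).
Hypothesis N0 : N 0.
Hypothesis ND : forall x y, N x -> N y -> N (x + y).
Hypothesis NZ : forall a x, N x -> N (a *: x).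

Lemma combination_over_uniq (s t : seq V) (c : V -> R) :
  uniq t -> {subset s <= t} ->
  exists c', \sum_(b <- s) c b *: b = \sum_(b <- t) c' b *: b.
Proof.
move=> ut; elim: s => [_|b s IH st].
  by exists (fun=> 0); rewrite big_nil big1 // => b _; rewrite scale0r.
have [|c' c'E] := IH; first by move=> x sx; apply: st; rewrite inE sx orbT.
have tb : b \in t by apply: st; rewrite mem_head.
exists (fun x => (if x == b then c b else 0) + c' x).
rewrite big_cons c'E; under [RHS]eq_bigr => x _ do rewrite scalerDl.
rewrite big_split /=; congr (_ + _); rewrite (bigD1_seq b) //= eqxx.
by rewrite big1 ?addr0 // => x /negbTE ->; rewrite scale0r.
Qed.

(** Freeness enters only here: a relation with coefficients f1, f2, f3 holds in
    each coordinate on a basis, where it is Koszul as soon as f1 is regular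
    modulo (f2, f3), and the coordinates of p and q are chosen one by one. *)
Lemma free_koszul f1 f2 f3 u1 u2 u3 :
  free_submodule N ->
  (forall c1 c2 c3, f1 * c1 + f2 * c2 + f3 * c3 = 0 ->
     exists y z, c1 = f2 * y + f3 * z) ->
  N u1 -> N u2 -> N u3 -> f1 *: u1 + f2 *: u2 + f3 *: u3 = 0 ->
  exists p q, [/\ N p, N q & u1 = f2 *: p + f3 *: q].
Proof.
move=> [B [BN span indep]] koszul.
move=> /span[s1 [c1 [s1B ->]]] /span[s2 [c2 [s2B ->]]] /span[s3 [c3 [s3B ->]]].
(* The three elements are compared on one common finite part of the basis. *)
pose t := undup (s1 ++ s2 ++ s3).
have ut : uniq t by rewrite undup_uniq.
have tB b : b \in t -> B b.
  by rewrite mem_undup !mem_cat => /or3P[/s1B|/s2B|/s3B].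
have [|d1 ->] := @combination_over_uniq s1 t c1 ut.
  by move=> x sx; rewrite mem_undup !mem_cat sx.
have [|d2 ->] := @combination_over_uniq s2 t c2 ut.
  by move=> x sx; rewrite mem_undup !mem_cat sx orbT.
have [|d3 ->] := @combination_over_uniq s3 t c3 ut.
  by move=> x sx; rewrite mem_undup !mem_cat sx !orbT.
move=> rel.
have coef b : b \in t -> exists yz, d1 b = f2 * yz.1 + f3 * yz.2.
  move=> tb; suff [y [z e]] : exists y z, d1 b = f2 * y + f3 * z by exists (y, z).
  apply: (koszul _ (d2 b) (d3 b)).
  apply: (indep t (fun b => f1 * d1 b + f2 * d2 b + f3 * d3 b)) => //.
  rewrite -[RHS]rel !scaler_sumr -!big_split /=; apply: eq_bigr => x _.
  by rewrite !scalerDl !scalerA.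
have /choice[yz yzE] b : exists yz, b \in t -> d1 b = f2 * yz.1 + f3 * yz.2.
  by case: (boolP (b \in t)) => [/coef[w wE]|_]; [exists w|exists (0, 0)].
have Nsum (e : V -> R) : N (\sum_(b <- t) e b *: b).
  rewrite big_seq; elim/big_ind: _ => // b tb.
  by apply/NZ/BN/tB.
exists (\sum_(b <- t) (yz b).1 *: b), (\sum_(b <- t) (yz b).2 *: b).
split => //; rewrite !scaler_sumr -big_split /= big_seq [RHS]big_seq.
by apply: eq_bigr => b tb; rewrite yzE // scalerDl !scalerA.
Qed.

End FreeSubmodule.

(** * Logarithmic derivations and linear forms *)

Section LogDerivations.
Variables (K : fieldType) (m : nat).
Implicit Types (p q f g r : {mpoly K[m]}) (d : {mpoly K[m]} -> {mpoly K[m]}).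

Lemma derivationD d p q : derivation d -> d (p + q) = d p + d q.
Proof. by move=> [lin _]; rewrite -[p in LHS]scale1r lin scale1r. Qed.

Lemma derivation0 d : derivation d -> d 0 = 0.
Proof. by move=> hd; apply: (addrI (d 0)); rewrite -derivationD // !addr0. Qed.

Lemma derivationZ d a p : derivation d -> d (a *: p) = a *: d p.
Proof.
move=> hd; have [lin _] := hd.
by rewrite -[a *: p]addr0 lin derivation0 // addr0.
Qed.

Lemma derivationB d p q : derivation d -> d (p - q) = d p - d q.
Proof. by move=> hd; rewrite -scaleN1r derivationD // derivationZ // scaleN1r. Qed.

Lemma derivation_sum d (I : Type) (s : seq I) (F : I -> {mpoly K[m]}) :
  derivation d -> d (\sum_(i <- s) F i) = \sum_(i <- s) d (F i).
Proof.
move=> hd; elim: s => [|i s IH]; last by rewrite !big_cons derivationD // IH.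
by rewrite !big_nil derivation0.
Qed.

Lemma derivation_prod d (I : eqType) (s : seq I) (F : I -> {mpoly K[m]}) :
  derivation d -> (forall i, i \in s -> divides (F i) (d (F i))) ->
  divides (\prod_(i <- s) F i) (d (\prod_(i <- s) F i)).
Proof.
move=> hd; elim: s => [_|i s IH h].
  by rewrite big_nil; exists (d 1); rewrite mul1r.
have [|g gE] := IH; first by move=> j sj; apply: h; rewrite inE sj orbT.
have [e eE] := h i (mem_head _ _).
rewrite big_cons; have [_ ->] := hd; rewrite gE eE.
by exists (e + g); ring.
Qed.

Lemma mderivXU (i j : 'I_m) :
  ('X_j : {mpoly K[m]})^`M(i) = (j == i)%:R.
Proof.
rewrite mderivX mnmE; case: eqP => [->|_]; last by rewrite scale0r.
by rewrite -[X in (X - _)%MM]add0m addmK mpolyX0 scale1r.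
Qed.

Lemma derivation_mderiv2 f g (i j : 'I_m) :
  derivation (fun p => f * p^`M(i) + g * p^`M(j)).
Proof.
split=> [a p q|p q]; last by rewrite !mderivM; ring.
by rewrite !mderivD !mderivZ !mulrDr -!scalerAr scalerDr addrACA.
Qed.

Lemma log_derivations0 Q : @log_derivations K m Q 0.
Proof.
split; last by exists 0; rewrite mulr0.
by split=> [a p q|p q] /=; rewrite ?mulr0 ?mul0r ?scaler0 addr0.
Qed.

Lemma log_derivationsD Q x y :
  @log_derivations K m Q x -> log_derivations Q y -> log_derivations Q (x + y).
Proof.
move=> [[x1 x2] [g gE]] [[y1 y2] [h hE]]; split; last first.
  by exists (g + h); rewrite mulrDr -gE -hE.
have E p : (x + y) p = x p + y p by [].
split=> [a p q|p q]; rewrite !E.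
  by rewrite x1 y1 scalerDr addrACA.
by rewrite x2 y2 mulrDl mulrDr addrACA.
Qed.

Lemma log_derivationsZ Q f x :
  @log_derivations K m Q x -> log_derivations Q (f *: x).
Proof.
move=> [[x1 x2] [g gE]].
have E p : (f *: x) p = f * x p by [].
split; last by exists (f * g); rewrite E gE mulrCA.
split=> [a p q|p q]; rewrite !E.
  by rewrite x1 mulrDr -scalerAr.
by rewrite x2; ring.
Qed.

Lemma homog1E p : p \is 1.-homog -> p = \sum_i p@_U_(i) *: 'X_i.
Proof.
move=> /dhomogP hp; apply/mpolyP => u; rewrite raddf_sum /=.
have [/mdeg1P[i /eqP ->]|/eqP nu] := boolP (mdeg u == 1%N).
  rewrite (bigD1 i) //= mcoeffZ mcoeffXU eqxx mulr1 big1 ?addr0 // => j ji.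
  by rewrite mcoeffZ mcoeffXU (negbTE ji) mulr0.
rewrite big1 => [|i _].
  by apply: memN_msupp_eq0; apply/negP => /hp.
rewrite mcoeffZ mcoeffX; case: eqP => [e|_]; last by rewrite mulr0.
by case: nu; rewrite -e mdeg1.
Qed.

Lemma homog1_eq0 p : p \is 1.-homog -> (forall v, p.@[v] = 0) -> p = 0.
Proof.
move=> hp h; rewrite (homog1E hp) big1 // => i _.
have := h (fun j => (j == i)%:R); rewrite {1}(homog1E hp) raddf_sum /=.
rewrite (bigD1 i) //= mevalZ mevalXU eqxx mulr1 big1 => [|j /negbTE ji].
  by rewrite addr0 => ->; rewrite scale0r.
by rewrite mevalZ mevalXU ji mulr0.
Qed.

(** A linear form vanishing on the zeros of [X_k - r] vanishes everywhere after
    substituting r for X_k, and a linear form is determined by its values even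
    over a finite field. *)
Lemma homog1_proportional (k : 'I_m) r p : free_of k r -> r \is 1.-homog ->
  p \is 1.-homog -> (forall v, ('X_k - r).@[v] = 0 -> p.@[v] = 0) ->
  exists c, p = c *: ('X_k - r).
Proof.
move=> kr hr hp h; exists p@_U_(k).
have hX : ('X_k : {mpoly K[m]}) \is 1.-homog by rewrite dhomogX /= mdeg1.
have sE : subst k r p = p - p@_U_(k) *: ('X_k - r).
  rewrite {1 2}(homog1E hp) raddf_sum /= (bigD1 k) //= [in RHS](bigD1 k) //=.
  rewrite substZ substX eqxx scalerBr opprD opprK addrACA subrr add0r addrC.
  by congr (_ + _); apply: eq_bigr => j /negbTE jk; rewrite substZ substX jk.
apply/eqP; rewrite -subr_eq0 -sE; apply/eqP/homog1_eq0.
  by rewrite sE; apply: rpredB => //; apply/rpredZ/rpredB.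
move=> v; rewrite [subst k r p]/(_ \mPo _) comp_mpoly_meval; apply: h.
rewrite -comp_mpoly_meval -[_ \mPo _]/(subst k r _).
by rewrite rmorphB /= substX eqxx kr subrr meval0.
Qed.

Variables (B : set (set 'rV[K]_m)) (alpha : set 'rV[K]_m -> {mpoly K[m]}).
Hypothesis finB : finite_set B.
Hypothesis alphaP : forall H, B H -> linear_form_of H (alpha H).

Let Q := \big[*%R/1]_(H \in B) alpha H.

Lemma defining_polynomialE : Q = \prod_(H <- fset_set B) alpha H.
Proof. exact: fsbig_finite. Qed.

Lemma mem_fset_setP H : reflect (B H) (H \in fset_set B).
Proof. by rewrite in_fset_set //; apply: (iffP idP) => [/set_mem|/mem_set]. Qed.

Lemma log_derivations_from_forms d : derivation d ->
  (forall H, B H -> divides (alpha H) (d (alpha H))) -> log_derivations Q d.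
Proof.
move=> hd h; split=> //; rewrite defining_polynomialE.
by apply: derivation_prod => // H /mem_fset_setP; apply: h.
Qed.

Section Hyperplane.
Variables (H : set 'rV[K]_m) (k : 'I_m) (r : {mpoly K[m]}).
Hypotheses (kr : free_of k r) (hr : r \is 1.-homog).
Hypothesis HE : forall v : 'rV[K]_m, H v <-> ('X_k - r).@[v ord0] = 0.

Lemma linear_form_proportional p : linear_form_of H p ->
  exists2 c, c != 0 & p = c *: ('X_k - r).
Proof.
move=> [hp p0 Hp].
have [|c pE] := @homog1_proportional k r p kr hr hp.
  move=> v hv; pose w := \row_i v i : 'rV[K]_m.
  have wv : w ord0 =1 v by move=> i; rewrite mxE.
  by move: hv; rewrite -!(meval_eq _ wv) => /HE; rewrite Hp.
by exists c => //; apply: contra_neq p0 => c0; rewrite pE c0 scale0r.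
Qed.

(** Of the forms of the arrangement only that of H is killed by the substitution
    of r for X_k.  The cofactor of that form in Q survives it, so [d Q = Q g]
    forces the substitution to kill the image of the form under d. *)
Lemma log_derivations_form d : B H -> log_derivations Q d ->
  divides ('X_k - r) (d ('X_k - r)).
Proof.
move=> BH [hd [g]]; rewrite defining_polynomialE.
have [c c0 aE] := linear_form_proportional (alphaP BH).
rewrite (bigD1_seq H) /=; [|exact/mem_fset_setP|exact: fset_uniq].
have [_ ->] := hd => e.
have sX : subst k r ('X_k - r) = 0 by rewrite rmorphB /= substX eqxx kr subrr.
apply: divides_subst.
have := congr1 (subst k r) e; rewrite aE derivationZ // !(rmorphM, rmorphD) /=.
rewrite !substZ sX scaler0 !mul0r addr0 => /eqP.
rewrite mulf_eq0 scaler_eq0 (negbTE c0) /= => /orP[/eqP //|].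
rewrite rmorph_prod prodf_seq_eq0 => /hasP[H' /mem_fset_setP BH' /andP[/eqP HH']].
have [hp p0 H'E] := alphaP BH'.
move=> /eqP /divides_subst [f fE]; case: HH'.
have [|c' pE] := @homog1_proportional k r (alpha H') kr hr hp.
  by move=> v hv; rewrite fE mevalM hv mul0r.
rewrite H'E; apply/seteqP; split=> v /=.
  rewrite pE mevalZ => /eqP; rewrite mulf_eq0 => /orP[/eqP c'0|/eqP /HE //].
  by rewrite pE c'0 scale0r eqxx in p0.
by move=> /HE hv; rewrite pE mevalZ hv mulr0.
Qed.

End Hyperplane.
End LogDerivations.

(** * The forms of the cone *)

Section ConeForms.
Variables (K : fieldType) (n : nat).
Implicit Types (i j : 'I_n) (a : K).

Definition vertex_var i : {mpoly K[n.+1]} := 'X_(lift ord_max i).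
Definition cone_var : {mpoly K[n.+1]} := 'X_ord_max.

(** The cone over the hyperplane [x_i - x_j = a] is cut out by
    [X_i - shift_form j a], which has the shape required for substitutions. *)
Definition shift_form j a := vertex_var j + a *: cone_var.

Lemma edge_formE i j a : 'X_(lift ord_max i) - shift_form j a =
  (vertex_var i - vertex_var j) - a *: cone_var.
Proof. by rewrite /shift_form opprD addrA. Qed.

Lemma free_of_shift_form i j a :
  i != j -> free_of (lift ord_max i) (shift_form j a).
Proof.
move=> ij; apply: free_ofD; last first.
  by apply/free_ofZ/free_ofX/neq_lift.
by apply: free_ofX; rewrite (inj_eq lift_inj) eq_sym.
Qed.

Lemma shift_form_homog j a : shift_form j a \is 1.-homog.
Proof. by apply: rpredD; rewrite ?rpredZ // dhomogX /= mdeg1. Qed.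

Lemma shift_form_inj j : injective (shift_form j).
Proof.
move=> a b /addrI /(congr1 (fun p => p@_U_(ord_max))) /=.
by rewrite !mcoeffZ mcoeffXU eqxx !mulr1.
Qed.

Lemma cone_hyperplaneE i j a (v : 'rV[K]_n.+1) :
  cone_hyperplane i j a v <->
  ('X_(lift ord_max i) - shift_form j a).@[v ord0] = 0.
Proof.
rewrite /cone_hyperplane /= mevalB mevalD mevalZ !mevalXU opprD addrA.
by split=> [->|/eqP]; [rewrite subrr|rewrite subr_eq0 => /eqP].
Qed.

Lemma hyperplane_at_infinityE (v : 'rV[K]_n.+1) :
  hyperplane_at_infinity v <-> ('X_ord_max - 0 : {mpoly K[n.+1]}).@[v ord0] = 0.
Proof. by rewrite subr0 mevalXU. Qed.

Lemma cone_hyperplane_swap i j a :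
  cone_hyperplane i j a = cone_hyperplane j i (- a).
Proof.
apply/seteqP; split=> v; rewrite /cone_hyperplane /= mulNr.
  by move=> <-; rewrite opprB.
by move=> /(congr1 -%R); rewrite opprB opprK.
Qed.

Variables (E : rel 'I_n) (gain : 'I_n -> 'I_n -> {fset K}).
Hypothesis gainE : gain_family E gain.

Lemma gain_swap i j a : i != j -> a \in gain i j -> - a \in gain j i.
Proof. by move=> /gainE[-> _] ha; apply/imfsetP; exists a. Qed.

(** The symmetry of the gains removes the orientation [i < j]. *)
Lemma gain_coneP H : gain_cone gain H <->
  H = hyperplane_at_infinity (n := n) \/
  exists i j a, [/\ i != j, a \in gain i j & H = cone_hyperplane i j a].
Proof.
split=> [[[i [j [a [ij ha ->]]]]|->]|[->|[i [j [a [ij ha ->]]]]]].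
- by right; exists i, j, a; split; rewrite // neq_ltn ij.
- by left.
- by right.
- left; case: (ltngtP i j) => ij'.
  + by exists i, j, a.
  + exists j, i, (- a); split; rewrite // ?gain_swap //.
    exact: cone_hyperplane_swap.
  + by rewrite (val_inj ij') eqxx in ij.
Qed.

Lemma gain_edge i j a : i != j -> a \in gain i j -> E i j.
Proof. by move=> /gainE[_ <-] ha; apply/eqP => s0; rewrite s0 in_fset0 in ha. Qed.

End ConeForms.

(** * Hyperplanes through the flat of a chordless cycle *)

Section ChordlessCycle.
Variables (K : fieldType) (n : nat) (E : rel 'I_n).
Variables (gain : 'I_n -> 'I_n -> {fset K}).
Hypotheses (simpleE : simple_graph E) (gainE : gain_family E gain).
Variables (alpha : set 'rV[K]_n.+1 -> {mpoly K[n.+1]}).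
Hypothesis finB : finite_set (gain_cone gain).
Hypothesis alphaP : forall H, gain_cone gain H -> linear_form_of H (alpha H).
Let Q := \big[*%R/1]_(H \in gain_cone gain) alpha H.

Variable c : seq 'I_n.
Hypotheses (uc : uniq c) (cE : cycle E c).
Hypothesis chordless : forall x y, x \in c -> y \in c -> E x y ->
  y = next c x \/ x = next c y.

Local Notation x_ := (@vertex_var K n).
Local Notation y_ := (cone_var K n).
Let nxt := next c.

Lemma next_edge i : i \in c -> E i (nxt i).
Proof. exact: next_cycle. Qed.

Lemma next_neq i : i \in c -> i != nxt i.
Proof.
move=> ci; apply/eqP => e; have := next_edge ci.
by rewrite -e; have [_ ->] := simpleE.
Qed.

Lemma next_inj : injective nxt.
Proof. exact: can_inj (prev_next uc). Qed.

Definition cycle_prod i : {mpoly K[n.+1]} :=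
  \prod_(a <- gain i (nxt i)) ('X_(lift ord_max i) - shift_form (nxt i) a).

Lemma cycle_prod_neq0 i : i \in c -> cycle_prod i != 0.
Proof.
by move=> ci; apply: prod_XB_neq0 => a; apply/free_of_shift_form/next_neq.
Qed.

Lemma free_of_cycle_prod i j : i != j -> i != nxt j ->
  free_of (lift ord_max i) (cycle_prod j).
Proof.
move=> ij inj; apply: free_of_prod => a; apply: free_ofB.
  by apply: free_ofX; rewrite (inj_eq lift_inj) eq_sym.
exact: free_of_shift_form.
Qed.

Lemma sum_differences : \sum_(i <- c) (x_ i - x_ (nxt i)) = 0.
Proof.
rewrite sumrB; apply/eqP; rewrite subr_eq0; apply/eqP.
rewrite -(big_map nxt predT x_); apply: perm_big; apply: uniq_perm => //.
  by rewrite map_inj_uniq //; apply: next_inj.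
move=> i; apply/idP/mapP => [ci|[j cj ->]]; last by rewrite mem_next.
by exists (prev c i); rewrite ?mem_prev // /nxt next_prev.
Qed.

(** Since [d y = y g], the difference of d and g times the Euler field kills y
    and is still logarithmic.  It thus sends b_i to a multiple of each
    [b_i - a y], and these forms are pairwise coprime. *)
Lemma log_derivation_cycle d : log_derivations Q d -> exists g,
  d y_ = y_ * g /\
  forall i, i \in c ->
    divides (cycle_prod i) (d (x_ i - x_ (nxt i)) - g * (x_ i - x_ (nxt i))).
Proof.
move=> hd; have [hd' _] := hd.
have [g gE] : divides y_ (d y_).
  have homog0 : (0 : {mpoly K[n.+1]}) \is 1.-homog by rewrite rpred0.
  have := log_derivations_form finB alphaP (@free_of0 K _ (@ord_max n)) homog0
    (@hyperplane_at_infinityE K n) _ hd.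
  by rewrite subr0; apply; apply/(gain_coneP gainE); left.
exists g; split=> // i ci; have ij := next_neq ci.
apply: prod_divides => [a||//|a ha].
- exact: free_of_shift_form.
- exact: shift_form_inj.
have := log_derivations_form finB alphaP (free_of_shift_form a ij)
   (shift_form_homog _ a) (cone_hyperplaneE i (nxt i) a) _ hd.
case; first by apply/(gain_coneP gainE); right; exists i, (nxt i), a.
rewrite edge_formE; set b := x_ i - x_ (nxt i).
rewrite derivationB // derivationZ // gE -!mul_mpolyC => f fE; exists (f - g).
by rewrite [RHS]mulrBr -fE; ring.
Qed.

Variable base : 'I_n.
Hypothesis base_c : base \in c.

(** Restriction to the flat X where y and all b_i vanish, with [x_base] chosen as
    the common coordinate: the target is again the polynomial ring, hence a
    domain. *)
Definition collapse : {rmorphism {mpoly K[n.+1]} -> {mpoly K[n.+1]}} :=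
  comp_mpoly [tuple if unlift ord_max k is Some i
    then x_ (if i \in c then base else i) else 0 | k < n.+1].

Lemma collapse_vertex i : collapse (x_ i) = x_ (if i \in c then base else i).
Proof. by rewrite [LHS]comp_mpolyXU -tnth_nth tnth_mktuple liftK. Qed.

Lemma collapse_cone : collapse y_ = 0.
Proof. by rewrite [LHS]comp_mpolyXU -tnth_nth tnth_mktuple unlift_none. Qed.

Lemma collapseZ a p : collapse (a *: p) = a *: collapse p.
Proof. exact: comp_mpolyZ. Qed.

Lemma collapse_shift_form i a :
  collapse (shift_form i a) = x_ (if i \in c then base else i).
Proof.
by rewrite rmorphD /= collapse_vertex collapseZ collapse_cone scaler0 addr0.
Qed.

Lemma collapse_cycle_prod i : i \in c -> collapse (cycle_prod i) = 0.
Proof.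
move=> ci; have [_ [_ /(_ (next_edge ci))]] := gainE (next_neq ci).
move=> /fset0Pn[a ha]; rewrite /cycle_prod (big_rem a) //= rmorphM rmorphB /=.
by rewrite collapse_shift_form collapse_vertex mem_next ci subrr mul0r.
Qed.

(** The factor L: multiplying by it stands in for inverting the forms that do not
    vanish on X. *)
Definition away : {mpoly K[n.+1]} :=
  \prod_(H <- fset_set (gain_cone gain) | collapse (alpha H) != 0) alpha H.

Lemma collapse_away : collapse away != 0.
Proof.
rewrite rmorph_prod prodf_seq_neq0; apply/allP => H _.
by apply/implyP.
Qed.

(** If the form of an edge [i, j] vanishes on X then i and j lie on the cycle,
    and an edge between two vertices of a chordless cycle is an edge of it. *)
Lemma collapsed_hyperplane H : gain_cone gain H -> collapse (alpha H) = 0 ->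
  H = hyperplane_at_infinity (n := n) \/
  exists i a, [/\ i \in c, a \in gain i (nxt i) &
                  H = cone_hyperplane i (nxt i) a].
Proof.
move=> BH; have := BH => /(gain_coneP gainE)[-> _|]; first by left.
move=> [i [j [a [ij ha HE]]]] aH; right.
have [|e e0 aE] := linear_form_proportional (free_of_shift_form a ij)
  (shift_form_homog _ a) _ (alphaP BH).
  by move=> v; rewrite HE; apply: cone_hyperplaneE.
have eqb : (if i \in c then base else i) = if j \in c then base else j.
  move: aH; rewrite aE collapseZ rmorphB /= => /eqP.
  rewrite scaler_eq0 (negbTE e0) /= subr_eq0 collapse_shift_form => /eqP.
  rewrite -[X in collapse X]/(x_ i) collapse_vertex.
  move=> /(congr1 (mcoeff U_(lift ord_max (if i \in c then base else i)))).
  rewrite !mcoeffXU eqxx (inj_eq lift_inj); case: eqP => [->//|_] /eqP.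
  by rewrite oner_eq0.
have [ci cj] : i \in c /\ j \in c.
  move: eqb ij; case: ifP => ci; case: ifP => cj // ee; move: base_c.
  - by rewrite ee cj.
  - by rewrite -ee ci.
  - by rewrite ee eqxx.
have [ee|ee] := chordless ci cj (gain_edge gainE ij ha).
  by exists i, a; rewrite /nxt -ee.
exists j, (- a); rewrite /nxt -ee; split=> //; first exact: (gain_swap gainE).
by rewrite HE; apply: cone_hyperplane_swap.
Qed.

(** The hyperplanes away from X are taken care of by L, those through X by the
    values of d on y and on the b_i. *)
Lemma log_derivation_local d : derivation d -> d y_ = 0 ->
  (forall p, divides away (d p)) ->
  (forall i, i \in c -> divides (cycle_prod i) (d (x_ i - x_ (nxt i)))) ->
  log_derivations Q d.
Proof.
move=> hd dy dL dP; apply: (log_derivations_from_forms finB) => // H BH.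
have [aH|aH] := eqVneq (collapse (alpha H)) 0; last first.
  apply: divides_trans (dL _); apply: divides_prod => //.
  exact/mem_fset_setP.
have [HE|[i [a [ci ha HE]]]] := collapsed_hyperplane BH aH.
  have homog0 : (0 : {mpoly K[n.+1]}) \is 1.-homog by rewrite rpred0.
  have [|e e0 aE] := linear_form_proportional
    (@free_of0 K _ (@ord_max n)) homog0 _ (alphaP BH).
    by move=> v; rewrite HE; apply: hyperplane_at_infinityE.
  by rewrite aE derivationZ // subr0 dy scaler0; apply: divides0.
have [|e e0 aE] := linear_form_proportional
  (free_of_shift_form a (next_neq ci)) (shift_form_homog _ a) _ (alphaP BH).
  by move=> v; rewrite HE; apply: cone_hyperplaneE.
have dE : d (alpha H) = e *: d (x_ i - x_ (nxt i)).
  rewrite aE edge_formE derivationZ // [d (_ - _ *: _)]derivationB //.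
  by rewrite [d (_ *: _)]derivationZ // dy scaler0 subr0.
have [g gE] : divides (cycle_prod i) (d (x_ i - x_ (nxt i))) by apply: dP.
have [f fE] : divides ('X_(lift ord_max i) - shift_form (nxt i) a) (cycle_prod i).
  by apply: divides_prod.
exists (f * g); rewrite dE gE fE aE -scalerAl; congr (_ *: _); by ring.
Qed.

End ChordlessCycle.

(** * The obstruction on four consecutive vertices *)

Section LongChordlessCycle.
Variables (K : fieldType) (n : nat) (E : rel 'I_n).
Variables (gain : 'I_n -> 'I_n -> {fset K}).
Hypotheses (simpleE : simple_graph E) (gainE : gain_family E gain).
Variables (alpha : set 'rV[K]_n.+1 -> {mpoly K[n.+1]}).
Hypothesis finB : finite_set (gain_cone gain).
Hypothesis alphaP : forall H, gain_cone gain H -> linear_form_of H (alpha H).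
Let Q := \big[*%R/1]_(H \in gain_cone gain) alpha H.

Variables (v1 v2 v3 v4 : 'I_n) (s : seq 'I_n).
Let c := [:: v1, v2, v3, v4 & s].
Hypotheses (uc : uniq c) (cE : cycle E c).
Hypothesis chordless : forall x y, x \in c -> y \in c -> E x y ->
  y = next c x \/ x = next c y.

Local Notation x_ := (@vertex_var K n).
Local Notation y_ := (cone_var K n).
Let P := cycle_prod gain c.
Let L := away gain alpha c v1.

Lemma v1_c : v1 \in c. Proof. by rewrite inE eqxx. Qed.
Lemma v2_c : v2 \in c. Proof. by rewrite !inE eqxx orbT. Qed.
Lemma v3_c : v3 \in c. Proof. by rewrite !inE eqxx !orbT. Qed.

Lemma vertices_distinct :
  [/\ v1 != v2, v1 != v3, v1 != v4, v2 != v3 & v2 != v4].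
Proof.
move: uc; rewrite /c /= !inE !negb_or.
by move=> /andP[/and4P[? ? ? _] /andP[/and3P[? ? _] _]].
Qed.

Lemma next1 : next c v1 = v2. Proof. by rewrite /= eqxx. Qed.

Lemma next2 : next c v2 = v3.
Proof.
have [h _ _ _ _] := vertices_distinct.
by rewrite /= eq_sym (negbTE h) eqxx.
Qed.

Lemma next3 : next c v3 = v4.
Proof.
have [_ h _ h' _] := vertices_distinct.
by rewrite /= ![v3 == _]eq_sym (negbTE h) (negbTE h') eqxx.
Qed.

(** The three derivations of the obstruction move only the two inner vertices of
    the path v1, v2, v3, v4. *)
Definition field23 (f g : {mpoly K[n.+1]}) :
    {mpoly K[n.+1]} -> {mpoly K[n.+1]}^o :=
  fun p => f * p^`M(lift ord_max v2) + g * p^`M(lift ord_max v3).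

Lemma field23_cone f g : field23 f g y_ = 0.
Proof.
have far i : (ord_max == lift ord_max i) = false by rewrite (negbTE (neq_lift _ _)).
by rewrite /field23 !mderivXU !far !mulr0 addr0.
Qed.

Lemma field23_edge f g i : i \in c -> field23 f g (x_ i - x_ (next c i)) =
  if i == v1 then - f else if i == v2 then f - g else if i == v3 then g else 0.
Proof.
move=> ci; rewrite /field23 !mderivB !mderivXU !(inj_eq lift_inj).
have -> : (next c i == v2) = (i == v1) by rewrite -next1 (inj_eq (next_inj uc)).
have -> : (next c i == v3) = (i == v2) by rewrite -next2 (inj_eq (next_inj uc)).
have [h12 h13 _ h23 _] := vertices_distinct.
have [->|_] := eqVneq i v1.
  by rewrite (negbTE h12) (negbTE h13) /=; ring.
have [->|_] := eqVneq i v2.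
  by rewrite (negbTE h23) /=; ring.
by case: eqP => _ /=; ring.
Qed.

Lemma field23_log f g : divides L f -> divides L g -> divides (P v1) f ->
  divides (P v2) (f - g) -> divides (P v3) g -> log_derivations Q (field23 f g).
Proof.
move=> Lf Lg f1 fg2 g3.
apply: (log_derivation_local simpleE gainE finB alphaP cE chordless v1_c).
- exact: derivation_mderiv2.
- exact: field23_cone.
- by move=> p; apply: dividesD; apply: divides_mulr.
- move=> i ci; rewrite field23_edge //.
  case: eqP => [->|_]; first exact: dividesN.
  case: eqP => [-> //|_]; case: eqP => [-> //|_]; exact: divides0.
Qed.

(** P2 is a product of forms [X_v2 - r], and X_v2 does not occur in P3. *)
Lemma divides_P3_P2 w : divides (P v3) (P v2 * w) -> divides (P v3) w.
Proof.
have [_ _ _ h23 h24] := vertices_distinct.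
apply: nonzerodiv_mod_free.
- by move=> a; apply/free_of_shift_form/(next_neq simpleE cE)/v2_c.
- exact/(cycle_prod_neq0 _ simpleE cE)/v3_c.
- by apply: free_of_cycle_prod => //; rewrite next3.
Qed.

(** P1 is a product of forms [X_v1 - r], and X_v1 occurs neither in P2 nor in P3:
    this is where v4 has to differ from v1. *)
Lemma koszul_P123 c1 c2 c3 : P v1 * c1 + P v2 * c2 + P v3 * c3 = 0 ->
  exists y z, c1 = P v2 * y + P v3 * z.
Proof.
have [h12 h13 h14 _ _] := vertices_distinct.
move=> e; have free_r a : free_of (lift ord_max v1) (shift_form (K := K) (next c v1) a).
  by apply/free_of_shift_form/(next_neq simpleE cE)/v1_c.
apply: (nonzerodiv_mod_pair free_r (s := gain v1 (next c v1)) (u := - c2) (v := - c3)).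
- by apply: free_of_cycle_prod => //; rewrite next2.
- by apply: free_of_cycle_prod => //; rewrite next3.
- exact/(cycle_prod_neq0 _ simpleE cE)/v3_c.
- exact: divides_P3_P2.
- apply/eqP; rewrite !mulrN -opprD -addr_eq0 addrA; apply/eqP; exact: e.
Qed.

(** If u1 lies in P2 D + P3 D, with D the module of logarithmic derivations, then
    L lies in the ideal of the P_i.  The multiples g and h of the Euler field in
    p and q cancel, since u1 kills y. *)
Lemma away_in_ideal p q : log_derivations Q p -> log_derivations Q q ->
  (forall f, field23 0 (L * (P v2 * P v3)) f = P v2 * p f + P v3 * q f) ->
  exists d, L + \sum_(i <- c) P i * d i = 0.
Proof.
move=> pD qD u1E.
have cyc := log_derivation_cycle simpleE gainE finB alphaP cE.
have [g [py pE]] := cyc _ pD; have [h [qy qE]] := cyc _ qD.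
have [hp _] := pD.
have gh : P v2 * g + P v3 * h = 0.
  have y0 : y_ != 0.
    by rewrite -[y_]subr0; apply/XB_neq0/free_of0.
  have := u1E y_; rewrite field23_cone py qy => e.
  by apply: (mulfI y0); rewrite mulr0 e; ring.
pose delta i : {mpoly K[n.+1]} := if i == v3 then L else 0.
(* Modulo P3, the syzygy attached to p is L times the basis vector at v3. *)
have key i : i \in c -> exists d,
    p (x_ i - x_ (next c i)) - g * (x_ i - x_ (next c i)) =
    P i * (delta i + P v3 * d).
  move=> ci; have := u1E (x_ i - x_ (next c i)); rewrite field23_edge //.
  have [e eE] := pE i ci; have [f fE] := qE i ci; rewrite eE.
  move: eE fE; set b := x_ i - x_ (next c i); set pb := p b; set qb := q b.
  clearbody pb qb b.
  move=> /eqP; rewrite subr_eq => /eqP -> /eqP; rewrite subr_eq => /eqP ->.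
  rewrite !mulrDr addrACA !(mulrA _ _ b) -mulrDl gh mul0r addr0 -/(P i).
  rewrite !(mulrCA _ (P i)) -mulrDr => uE.
  have Pi0 : P i != 0 by apply: (cycle_prod_neq0 gain simpleE cE ci).
  suff [d dE] : divides (P v3) (e - delta i) by exists d; rewrite -dE addrC subrK.
  (* u1 sends b_v2 to - L P2 P3 and b_v3 to L P2 P3, and kills the other b_i;
     the term in L below accounts for v2. *)
  apply: divides_P3_P2; exists (- f - (if i == v2 then L else 0)).
  apply: (mulfI Pi0); rewrite mulrBr -[P v2 * e](addrK (P v3 * f)) 2!mulrBr -uE.
  have [h12 h13 _ h23 _] := vertices_distinct; rewrite /delta.
  have [iE|_] := eqVneq i v1.
    by rewrite iE (negbTE h12) (negbTE h13); ring.
  have [iE|_] := eqVneq i v2.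
    by rewrite iE (negbTE h23); ring.
  by have [iE|_] := eqVneq i v3; [rewrite iE|]; ring.
have /choice[d dE] i : exists d, i \in c ->
    p (x_ i - x_ (next c i)) - g * (x_ i - x_ (next c i)) =
    P i * (delta i + P v3 * d).
  by case: (boolP (i \in c)) => [/key[d dE]|_]; [exists d|exists 0].
(* The b_i add up to 0, and so do the values of p minus g times Euler on them. *)
have sum0 : P v3 * (L + \sum_(i <- c) P i * d i) = 0.
  transitivity (\sum_(i <- c)
      (p (x_ i - x_ (next c i)) - g * (x_ i - x_ (next c i)))).
    rewrite [RHS]big_seq (eq_bigr _ dE) -big_seq.
    under [RHS]eq_bigr => i _ do rewrite mulrDr mulrCA.
    rewrite big_split /= -mulr_sumr mulrDr; congr (_ + _).
    rewrite (bigD1_seq v3) ?v3_c //= /delta eqxx big1 => [|i /negbTE ->].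
      by rewrite addr0.
    by rewrite mulr0.
  rewrite sumrB -mulr_sumr -derivation_sum // sum_differences //.
  by rewrite derivation0 // mulr0 subr0.
exists d; apply/eqP; move/eqP: sum0.
by rewrite mulf_eq0 (negbTE (cycle_prod_neq0 gain simpleE cE v3_c)).
Qed.

Lemma not_free_of_long_chordless_cycle : ~ free_submodule (log_derivations Q).
Proof.
move=> freeD.
have Ld f : divides L (L * f) by apply/divides_mulr/divides_refl.
have LdN f : divides L (- (L * f)) by apply: dividesN.
have Pd i f : divides (P i) (f * P i) by apply/divides_mull/divides_refl.
pose u1 := field23 0 (L * (P v2 * P v3)).
pose u2 := field23 (- (L * (P v1 * P v3))) (- (L * (P v1 * P v3))).
pose u3 := field23 (L * (P v1 * P v2)) 0.
have u1D : log_derivations Q u1.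
  apply: field23_log => //; try exact: divides0; last by rewrite mulrA.
  by rewrite sub0r [P v2 * _]mulrC mulrA; apply: dividesN.
have u2D : log_derivations Q u2.
  apply: field23_log => //; last by rewrite mulrA; apply: dividesN.
    by rewrite [P v1 * _]mulrC mulrA; apply: dividesN.
  by rewrite subrr; apply: divides0.
have u3D : log_derivations Q u3.
  apply: field23_log => //; try exact: divides0.
    by rewrite [P v1 * _]mulrC mulrA.
  by rewrite subr0 mulrA.
have rel : P v1 *: u1 + P v2 *: u2 + P v3 *: u3 = 0.
  apply: funext => p.
  rewrite -[LHS]/(P v1 * u1 p + P v2 * u2 p + P v3 * u3 p).
  rewrite -[RHS]/(0 : {mpoly K[n.+1]}) /u1 /u2 /u3 /field23.
  by set a := p^`M(_); set b := p^`M(_); ring.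
have [p [q [pD qD u1E]]] := free_koszul (@log_derivations0 _ _ Q)
  (@log_derivationsD _ _ Q) (@log_derivationsZ _ _ Q) freeD koszul_P123
  u1D u2D u3D rel.
have [|d L0] := away_in_ideal pD qD; first by move=> f; rewrite -/u1 u1E.
have /eqP := collapse_away gain alpha c v1; apply.
have := congr1 (collapse K c v1) L0.
rewrite rmorphD rmorph_sum rmorph0 /= big_seq big1 ?addr0 // => i ci.
by rewrite rmorphM /= (collapse_cycle_prod simpleE gainE cE v1 ci) mul0r.
Qed.

End LongChordlessCycle.

Theorem theorem1p2 (K : fieldType) (n : nat) (E : rel 'I_n)
    (gain : 'I_n -> 'I_n -> {fset K}) :
  simple_graph E -> gain_family E gain ->
  free_arrangement (gain_cone gain) -> chordal E.
Proof.
move=> simpleE gainE [Q [[finB [alpha [alphaP ->]]] freeD]] c.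
case: c => [|v1 [|v2 [|v3 [|v4 s]]]] // _ /andP[cE uc].
set c := [:: v1, v2, v3, v4 & s] in cE uc *.
apply: contrapT => no_chord.
have chordless x y : x \in c -> y \in c -> E x y -> y = next c x \/ x = next c y.
  move=> cx cy xy; have [->|nx] := eqVneq y (next c x); first by left.
  have [->|ny] := eqVneq x (next c y); first by right.
  by case: no_chord; exists x, y.
exact: (not_free_of_long_chordless_cycle simpleE gainE finB alphaP uc cE chordless).
Qed.
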